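(* Let $G$ be the $7$-regular infinite planar triangulation and fix a root vertex $o$ of $G$. There is a constant $c>0$, depending only on $G$, such that for every integer $n\ge 1$ the following holds: if $\gamma$ is an $n$-step self avoiding walk on $G$ started at $o$, i.e. a uniformly random element of the set of all self avoiding paths of length $n$ in $G$ starting at $o$, then the expected graph distance in $G$ between the starting point and the endpoint of $\gamma$ is bigger than $cn$.
   Context: The $7$-regular infinite planar triangulation is the infinite, simply connected planar triangulation in which every vertex has degree $7$; equivalently, it is the vertex-edge graph of the tessellation of the hyperbolic plane by equilateral triangles with seven triangles meeting at each vertex (Schläfli symbol $\{3,7\}$). It is vertex transitive. A self avoiding path of length $n$ is a sequence of $n+1$ pairwise distinct vertices in which consecutive vertices are adjacent in $G$. The $n$-step self avoiding walk (SAW) is the uniform probability measure on the (finite) set of all length $n$ self avoiding paths starting at a fixed root. The displacement is the graph distance between the first and last vertices of the path. *)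

(* Defs.v *)
From Stdlib Require Import Relations.
From mathcomp Require Import all_boot all_order all_algebra.
From mathcomp Require Import finmap.
From mathcomp Require Import boolp classical_sets functions cardinality fsbigop.
From mathcomp Require Import reals.

Set Implicit Arguments.
Unset Strict Implicit.
Unset Printing Implicit Defensive.

Import Order.TTheory GRing.Theory Num.Theory.
Local Open Scope classical_set_scope.
Local Open Scope ring_scope.

(* A simplicial complex of dimension at most 2 on the vertex type V; its
   1-skeleton is the simple graph (V, adj). The predicate face x y z does not
   depend on the order of x, y, z. *)
Record complex2 (V : choiceType) := Complex2 {
  adj : rel V ;
  face : V -> V -> V -> bool ;
  adj_sym : symmetric adj ;
  adj_irr : irreflexive adj ;
  face_swap12 : forall x y z, face x y z = face y x z ;
  face_swap23 : forall x y z, face x y z = face x z y ;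
  face_adj : forall x y z, face x y z -> adj x y
}.

Section Triangulation.
Variables (V : choiceType) (G : complex2 V).

Definition degree (v : V) : nat := #|` fset_set [set w | adj G v w] |.

Definition regular_graph (d : nat) : Prop :=
  forall v, finite_set [set w | adj G v w] /\ degree v = d.

(* The link of v is the simplicial circle whose vertices are, in cyclic
   order, the entries of s. *)
Definition link_is_cycle (v : V) (s : seq V) : Prop :=
  [/\ uniq s, (2 < size s)%N,
      forall w, adj G v w = (w \in s) &
      forall x y, face G v x y = (x \in s) && ((y == next s x) || (y == prev s x))].

(* Every vertex link is a circle: the realization of G is a surface without
   boundary, triangulated by G (and G is locally finite). *)
Definition triangulated_surface : Prop := forall v, exists s, link_is_cycle v s.

(* The walk o, p_1, ..., p_k is encoded by its origin o and p = [:: p_1; ...; p_k]. *)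
Definition walk (x y : V) (p : seq V) : Prop := path (adj G) x p /\ last x p = y.

Definition connected_graph : Prop := forall x y, exists p, walk x y p.

(* Elementary homotopies of edge paths, given by their full vertex lists:
   removing a spur, and replacing two sides of a face by the third. *)
Inductive homotopy_move : seq V -> seq V -> Prop :=
| move_spur p q x y : adj G x y ->
    homotopy_move (p ++ [:: x, y, x & q]) (p ++ [:: x & q])
| move_face p q x y z : face G x y z ->
    homotopy_move (p ++ [:: x, y, z & q]) (p ++ [:: x, z & q]).

Definition homotopic : relation (seq V) := clos_refl_sym_trans _ homotopy_move.

Definition simply_connected : Prop :=
  connected_graph /\
  forall x p, walk x x p -> homotopic (x :: p) [:: x].

(* A simply connected surface without boundary is the sphere or the plane, and
   it is the plane exactly when its (locally finite) triangulations are
   infinite; so these are the triangulations of the plane. *)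
Definition infinite_planar_triangulation : Prop :=
  [/\ triangulated_surface, simply_connected & infinite_set [set: V]].

Definition is_dist (x y : V) (k : nat) : Prop :=
  (exists2 p, walk x y p & size p = k) /\
  (forall p, walk x y p -> (k <= size p)%N).

(* The default value 0 is only taken when x and y are not connected. *)
Definition graph_dist (x y : V) : nat := xget 0%N [set k | is_dist x y k].

(* p stands for the path o :: p, which has n + 1 vertices. *)
Definition self_avoiding_paths (o : V) (n : nat) : set (seq V) :=
  [set p | [/\ path (adj G) o p, uniq (o :: p) & size p = n]].

End Triangulation.

(* Expectation of f under the uniform probability on a finite nonempty set A. *)
Definition uniform_expectation (R : realType) (T : choiceType) (A : set T)
    (f : T -> R) : R :=
  (\sum_(x \in A) f x) / (#|` fset_set A |)%:R.

Definition expected_displacement (R : realType) (V : choiceType)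
    (G : complex2 V) (o : V) (n : nat) : R :=
  uniform_expectation (self_avoiding_paths G o n)
    (fun p => (graph_dist G o (last o p))%:R).

(* Main.v *)
(* The graph is developed onto a model tiling M of the hyperbolic plane by
   horocyclic levels: the vertices of M are pairs (n, i) of integers, the letters
   of every level n form the same bi-infinite word, fixed by the substitution
   a -> baa, b -> ba, and letter i is joined to its neighbours i - 1 and i + 1, to
   the letters of its image in level n + 1 and to the one after them. Transporting
   local identifications with M along paths is invariant under elementary
   homotopies, so simple connectivity yields a map m from the graph to M respecting
   the links; its first coordinate is a 1-Lipschitz height.

   Two transfer-matrix estimates are then compared. Walks that never descend and
   never reverse a horizontal run are self-avoiding, and there are at least
   (5.13 ^ n) / 2 of them. On the other hand self-avoiding walks neither
   backtrack nor close a triangle, and the sum of (2/3) ^ (gain of height) over all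
   walks with this property is O(5.12 ^ n). Hence the mean of (2/3) ^ displacement
   decays exponentially, which forces linear mean displacement. *)

From Stdlib Require Import BinNat Nnat.
Require Import Defs.
From mathcomp Require Import all_boot all_order all_algebra.
From mathcomp Require Import finmap.
From mathcomp Require Import boolp classical_sets functions cardinality fsbigop.
From mathcomp Require Import reals.
From mathcomp Require Import zify ring lra.

Set Implicit Arguments.
Unset Strict Implicit.
Unset Printing Implicit Defensive.

Import Order.TTheory GRing.Theory Num.Theory.
Local Open Scope classical_set_scope.
Local Open Scope ring_scope.

(** * The fixed word of the substitution *)

(* A bi-infinite word in a, b fixed by a -> baa, b -> ba. The image of letter i
   occupies the positions from phi i to phi (i + 1) - 1, its first letter is the
   only b in it, and par j is the letter whose image contains position j. *)
Record substitution_word := SubstitutionWord {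
  isb : int -> bool;
  phi : int -> int;
  par : int -> int;
  phi_succ : forall i, phi (i + 1) = if isb i then phi i + 2 else phi i + 3;
  isb_phi : forall i, isb (phi i);
  phi_par : forall j, isb j -> phi (par j) = j;
  par_bounds : forall j, phi (par j) <= j < phi (par j + 1) }.

(* half_phi 0 gives phi on the nonnegative letters; half_phi 1 gives - phi (- k),
   for which letter - (k + 1) decides the increment from k to k + 1. *)
Fixpoint half_history (e k : nat) : seq nat :=
  if k is k'.+1 then
    let l := half_history e k' in
    (head 0 l + 2 + ((k' + e)%N \notin l))%N :: l
  else [:: 0%N].

Definition half_phi (e k : nat) : nat := head 0%N (half_history e k).

Lemma half_phiS e k :
  half_phi e k.+1 = (half_phi e k + 2 + ((k + e)%N \notin half_history e k))%N.
Proof. by []. Qed.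

Lemma half_phi_ge e k : (2 * k <= half_phi e k)%N.
Proof. by elim: k => // k IH; rewrite half_phiS; lia. Qed.

Lemma mem_half_history e k n :
  (n \in half_history e k) = [exists j : 'I_k.+1, half_phi e j == n].
Proof.
apply/idP/existsP => [|[[j /= jk] /eqP <-]].
  elim: k => [|k IH] /=.
    by rewrite inE => /eqP ->; exists ord0.
  rewrite inE => /orP[/eqP->|/IH[j /eqP <-]]; first by exists ord_max.
  by exists (widen_ord (leqnSn _) j).
elim: k jk => [|k IH]; first by case: j => //; rewrite inE.
rewrite ltnS leq_eqVlt => /orP[/eqP->|/IH]; rewrite inE ?eqxx//.
by move=> ->; rewrite orbT.
Qed.

(** As [half_phi e j] is at least [2 * j], a value up to [k + 1] is attained at an index at most
    [k]. Hence, for [e <= 1], the history already decides the letter [k + e] that the recursion asks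
    about. *)
Lemma half_historyP e k n : (n <= k + 1)%N ->
  reflect (exists j, half_phi e j = n) (n \in half_history e k).
Proof.
move=> nk; rewrite mem_half_history.
apply: (iffP existsP) => [[j /eqP]|[j jn]]; first by exists j.
have jk : (j < k.+1)%N by have := half_phi_ge e j; lia.
by exists (Ordinal jk); apply/eqP.
Qed.

Definition word_isb (j : int) : bool :=
  match j with Posz n => n \in half_history 0 n | Negz n => n.+1 \in half_history 1 n end.

Definition word_phi (i : int) : int :=
  match i with Posz n => Posz (half_phi 0 n) | Negz n => - Posz (half_phi 1 n.+1) end.

Lemma word_phi_succ i :
  word_phi (i + 1) = if word_isb i then word_phi i + 2 else word_phi i + 3.
Proof.
case: i => n.
  have -> : Posz n + 1 = Posz n.+1 by lia.
  rewrite /word_phi half_phiS /word_isb addn0.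
  by case: (_ \in _) => /=; lia.
have -> : Negz n + 1 = - Posz n by lia.
have -> : word_phi (- Posz n) = - Posz (half_phi 1 n) by case: n.
rewrite /word_phi half_phiS /word_isb addn1.
by case: (_ \in _) => /=; lia.
Qed.

Lemma word_isbP j : reflect (exists i, word_phi i = j) (word_isb j).
Proof.
case: j => n /=.
  apply: (iffP (half_historyP 0 _)); first lia.
    by move=> [k <-]; exists (Posz k).
  case=> -[k|k] /=; first by move=> [<-]; exists k.
  by have := half_phi_ge 1 k.+1; lia.
apply: (iffP (half_historyP 1 _)); first lia.
  by move=> [[|k]]// kn; exists (Negz k); rewrite /= kn; lia.
case=> -[k|k] /=; first lia.
by move=> E; exists k.+1; lia.
Qed.

Lemma word_par_ex (j : int) : exists p, word_phi p <= j < word_phi (p + 1).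
Proof.
have step i : word_phi i + 2 <= word_phi (i + 1).
  by rewrite word_phi_succ; case: ifP; lia.
have up (k : nat) : forall p, word_phi p <= j -> j < word_phi p + Posz k ->
    exists q, word_phi q <= j < word_phi (q + 1).
  elim: k => [|k IH] p p1 p2; first lia.
  have [lt|ge] := ltP j (word_phi (p + 1)); first by exists p; rewrite p1.
  by apply: (IH (p + 1)) => //; have := step p; lia.
have [p pj] : exists p, word_phi p <= j.
  (* On nonpositive letters [word_phi] lies below the identity, so this letter is a start from which
     [up] can climb to [j]. *)
  exists (- Posz `|j|%N).
  have neg (n : nat) : word_phi (- Posz n) <= - Posz n.
    by case: n => [|n] //=; have := half_phi_ge 1 n.+1; lia.
  by have := neg `|j|%N; lia.
by apply: (up `|(j - word_phi p)%R|.+1 p pj); lia.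
Qed.

Lemma substitution_word_exists : inhabited substitution_word.
Proof.
pose p j := projT1 (cid (word_par_ex j)).
have pP j : word_phi (p j) <= j < word_phi (p j + 1) by rewrite /p; case: cid.
apply: inhabits; apply: (@SubstitutionWord word_isb word_phi p) => //.
- exact: word_phi_succ.
- by move=> i; apply/word_isbP; exists i.
- move=> j /word_isbP[i ij].
  have mono (k : nat) a : word_phi a <= word_phi (a + Posz k).
    elim: k a => [|k IH] a; first by rewrite addr0.
    have -> : a + Posz k.+1 = (a + Posz k) + 1 by lia.
    apply: le_trans (IH a) _; rewrite word_phi_succ; case: ifP; lia.
  have /andP[p1 p2] := pP j.
  have [lt|gt|<-//] := ltgtP i (p j).
    have := mono `|(p j - i - 1)%R|%N (i + 1).
    have -> : i + 1 + `|(p j - i - 1)%R|%N = p j by lia.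
    by rewrite word_phi_succ; case: ifP; lia.
  have := mono `|(i - p j - 1)%R|%N (p j + 1).
  have -> : p j + 1 + `|(i - p j - 1)%R|%N = i by lia.
  by lia.
Qed.

(** * The tiling by horocyclic levels *)

Lemma val_Z7S (j : 'Z_7) : (j + 1 : 'Z_7) = (j.+1 %% 7)%N :> nat.
Proof. by rewrite /= modnDmr addn1. Qed.

Lemma val_Z7P (j : 'Z_7) : (j - 1 : 'Z_7) = ((j + 6) %% 7)%N :> nat.
Proof. by []. Qed.

Section LevelTiling.
Variable W : substitution_word.
Local Notation B := (isb W).
Local Notation phi := (phi W).
Local Notation par := (par W).

Lemma phi_monoD (k : nat) i : phi i + Posz k <= phi (i + Posz k).
Proof.
elim: k => [|k IH]; first by rewrite !addr0.
have -> : i + Posz k.+1 = (i + Posz k) + 1 by lia.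
by rewrite phi_succ; case: ifP; lia.
Qed.

Lemma par_unique q j : phi q <= j < phi (q + 1) -> par j = q.
Proof.
move=> /andP[q1 q2]; have /andP[p1 p2] := par_bounds W j.
have [lt|gt|//] := ltgtP (par j) q.
  have := phi_monoD `|(q - par j - 1)%R|%N (par j + 1).
  have -> : par j + 1 + Posz `|(q - par j - 1)%R|%N = q by lia.
  by lia.
have := phi_monoD `|(par j - q - 1)%R|%N (q + 1).
have -> : q + 1 + Posz `|(par j - q - 1)%R|%N = par j by lia.
by lia.
Qed.

Lemma par_phi q : par (phi q) = q.
Proof. by apply: par_unique; rewrite phi_succ; case: ifP; lia. Qed.

Lemma isbE j : B j = (j == phi (par j)).
Proof.
apply/idP/eqP => [/phi_par->//|->]; exact: isb_phi.
Qed.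

Lemma par_inner q : par (phi q + 1) = q.
Proof. by apply: par_unique; rewrite phi_succ; case: ifP; lia. Qed.

Lemma isb_inner q : B (phi q + 1) = false.
Proof. by rewrite isbE par_inner; lia. Qed.

Lemma par_inner2 q : ~~ B q -> par (phi q + 2) = q.
Proof. by move=> /negbTE bq; apply: par_unique; rewrite phi_succ bq; lia. Qed.

Lemma isb_inner2 q : ~~ B q -> B (phi q + 2) = false.
Proof. by move=> bq; rewrite isbE par_inner2//; lia. Qed.

Variant word_spec (i : int) : Type :=
| WordB q of B i & i = phi q & par i = q
| WordBA q of B q & ~~ B i & i = phi q + 1 & par i = q
| WordAA1 q of ~~ B q & ~~ B i & i = phi q + 1 & par i = q
| WordAA2 q of ~~ B q & ~~ B i & i = phi q + 2 & par i = q.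

Lemma wordP i : word_spec i.
Proof.
have /andP[] := par_bounds W i; rewrite phi_succ.
case: (boolP (B i)) => bi; first by move=> _ _; apply: (WordB bi) => //; rewrite phi_par.
have nphi : i != phi (par i) by rewrite -isbE.
case: ifP => bq h1 h2.
  by apply: (@WordBA i (par i)) => //; lia.
have [e|ne] := eqVneq i (phi (par i) + 1).
  by apply: (@WordAA1 i (par i)) => //; rewrite bq.
by apply: (@WordAA2 i (par i)) => //; rewrite ?bq//; lia.
Qed.

(* Neighbours of the i-th vertex of level n, in cyclic order. A letter b has two
   parents (it sits above the edge joining par i - 1 to par i), a letter a has one. *)
Definition level_link (m : int * int) : seq (int * int) :=
  let: (n, i) := m in
  if B i then
    [:: (n - 1, par i - 1); (n, i - 1); (n + 1, phi i); (n + 1, phi i + 1);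
        (n + 1, phi i + 2); (n, i + 1); (n - 1, par i)]
  else
    [:: (n - 1, par i); (n, i - 1); (n + 1, phi i); (n + 1, phi i + 1);
        (n + 1, phi i + 2); (n + 1, phi i + 3); (n, i + 1)].

Definition level_nbr (m : int * int) (j : 'Z_7) := nth m (level_link m) j.

(** Entry [j] is the position of the vertex in the link of its [j]-th neighbour. *)
Definition level_back_table (m : int * int) : seq nat :=
  let: (_, i) := m in
  if B i then [:: if B (par i - 1) then 4 else 5; 6; 6; 0; 0; 1; 2]%N
  else [:: if B (i - 1) then 3 else 4; if B (i - 1) then 5 else 6; 6; 0; 0; 0; 1]%N.

Definition level_back m (j : 'Z_7) : 'Z_7 := inZp (nth 0%N (level_back_table m) j).

Lemma level_nbr_inj m : injective (level_nbr m).
Proof.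
have: uniq (level_link m).
  by case: m => n i; rewrite /level_link; case: ifP => _ /=;
    rewrite !inE !xpair_eqE; lia.
have s7 : size (level_link m) = 7%N by case: m => n i; rewrite /level_link; case: ifP.
move=> u x y /eqP; rewrite /level_nbr nth_uniq ?s7 ?ltn_ord// => /eqP.
exact: val_inj.
Qed.

Lemma phi_pred q : phi (q - 1) = if B (q - 1) then phi q - 2 else phi q - 3.
Proof. by have := phi_succ W (q - 1); rewrite subrK; case: ifP; lia. Qed.

Lemma par_pred_phi q : par (phi q - 1) = q - 1.
Proof. by apply: par_unique; rewrite subrK phi_pred; case: ifP; lia. Qed.

Lemma isb_pred_phi q : B (phi q - 1) = false.
Proof. by rewrite isbE par_pred_phi phi_pred; case: ifP; lia. Qed.

(** Crossing an edge reverses the cyclic order, so the two common neighbours come after and before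
    [m] in the new link. This is the local consistency that [development] requires of a model. *)
Lemma level_nbr_back m j :
  [/\ level_nbr (level_nbr m j) (level_back m j) = m,
      level_nbr (level_nbr m j) (level_back m j + 1) = level_nbr m (j - 1) &
      level_nbr (level_nbr m j) (level_back m j - 1) = level_nbr m (j + 1)].
Proof.
rewrite /level_nbr !val_Z7S !val_Z7P /level_back.
case: m => n i.
have fin (a b c d e f g h k l x y : int) :
    a = b -> c = d -> e = f -> g = h -> k = l -> x = y ->
    [/\ (a, c) = (b, d), (e, g) = (f, h) & (k, x) = (l, y)].
  by do 6!move=> ->.
case: (wordP i) => q.
- move=> bi iq pi.
  case: j => -[|[|[|[|[|[|[|//]]]]]]] lt; rewrite /level_link /level_back_table bi pi /=.
  + by have [b1|/negbTE b1] := boolP (B (q - 1)); rewrite /= phi_pred b1; apply: fin; lia.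
  + by rewrite iq isb_pred_phi par_pred_phi /= phi_pred isb_pred_phi; apply: fin; lia.
  + by rewrite isb_phi par_phi /=; apply: fin; lia.
  + by rewrite isb_inner par_inner /=; apply: fin; lia.
  + have -> : phi i + 2 = phi (i + 1) by rewrite phi_succ bi.
    by rewrite isb_phi par_phi /= phi_succ bi; apply: fin; lia.
  + by rewrite iq isb_inner par_inner /= phi_succ -iq bi; apply: fin; lia.
  + by case: (B q) => /=; apply: fin; lia.
- move=> bq /negbTE bi iq pi.
  have b1 : B (i - 1) by rewrite iq addrK isb_phi.
  have p1 : par (i - 1) = q by rewrite iq addrK par_phi.
  have i1 : i + 1 = phi (q + 1) by rewrite phi_succ bq; lia.
  have ph : phi i = phi (i - 1) + 2 by rewrite -{1}(subrK 1 i) phi_succ b1.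
  case: j => -[|[|[|[|[|[|[|//]]]]]]] lt;
    rewrite /level_link /level_back_table bi pi b1 /=.
  + by rewrite bq /=; apply: fin; lia.
  + by rewrite b1 p1 /= ph; apply: fin; lia.
  + by rewrite isb_phi par_phi /=; apply: fin; lia.
  + by rewrite isb_inner par_inner /=; apply: fin; lia.
  + by rewrite isb_inner2 ?bi// par_inner2 ?bi//=; apply: fin; lia.
  + have -> : phi i + 3 = phi (i + 1) by rewrite phi_succ bi.
    by rewrite isb_phi par_phi /= phi_succ bi; apply: fin; lia.
  + by rewrite i1 isb_phi par_phi /= -i1 phi_succ bi; apply: fin; lia.
- move=> bq /negbTE bi iq pi.
  have b1 : B (i - 1) by rewrite iq addrK isb_phi.
  have p1 : par (i - 1) = q by rewrite iq addrK par_phi.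
  have i1 : i + 1 = phi q + 2 by lia.
  have bS : B (i + 1) = false by rewrite i1 isb_inner2.
  have pS : par (i + 1) = q by rewrite i1 par_inner2.
  have ph : phi i = phi (i - 1) + 2 by rewrite -{1}(subrK 1 i) phi_succ b1.
  have /negbTE bq' := bq.
  case: j => -[|[|[|[|[|[|[|//]]]]]]] lt;
    rewrite /level_link /level_back_table bi pi b1 /=.
  + by rewrite bq' /=; apply: fin; lia.
  + by rewrite b1 p1 /= ph; apply: fin; lia.
  + by rewrite isb_phi par_phi /=; apply: fin; lia.
  + by rewrite isb_inner par_inner /=; apply: fin; lia.
  + by rewrite isb_inner2 ?bi// par_inner2 ?bi//=; apply: fin; lia.
  + have -> : phi i + 3 = phi (i + 1) by rewrite phi_succ bi.
    by rewrite isb_phi par_phi /= phi_succ bi; apply: fin; lia.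
  + by rewrite bS pS /= phi_succ bi; apply: fin; lia.
- move=> bq /negbTE bi iq pi.
  have i0 : i - 1 = phi q + 1 by lia.
  have b1 : B (i - 1) = false by rewrite i0 isb_inner.
  have p1 : par (i - 1) = q by rewrite i0 par_inner.
  have i1 : i + 1 = phi (q + 1) by rewrite phi_succ (negbTE bq); lia.
  have ph : phi i = phi (i - 1) + 3 by rewrite -{1}(subrK 1 i) phi_succ b1.
  have /negbTE bq' := bq.
  case: j => -[|[|[|[|[|[|[|//]]]]]]] lt;
    rewrite /level_link /level_back_table bi pi b1 /=.
  + by rewrite bq' /=; apply: fin; lia.
  + by rewrite b1 p1 /= ph; apply: fin; lia.
  + by rewrite isb_phi par_phi /=; apply: fin; lia.
  + by rewrite isb_inner par_inner /=; apply: fin; lia.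
  + by rewrite isb_inner2 ?bi// par_inner2 ?bi//=; apply: fin; lia.
  + have -> : phi i + 3 = phi (i + 1) by rewrite phi_succ bi.
    by rewrite isb_phi par_phi /= phi_succ bi; apply: fin; lia.
  + by rewrite i1 isb_phi par_phi /= -i1 phi_succ bi; apply: fin; lia.
Qed.
End LevelTiling.

(** * Frames and the developing map *)

Section Frames.
Variables (V : choiceType) (G : complex2 V).

(** A cyclic labelling of the link, with arbitrary starting point and direction. *)
Definition frame (v : V) (f : 'Z_7 -> V) : Prop :=
  [/\ injective f,
      forall w, adj G v w <-> exists k, w = f k,
      forall k, face G v (f k) (f (k + 1)) &
      forall k l, face G v (f k) (f l) -> l = k + 1 \/ l = k - 1].

Lemma frame_shift v f c : frame v f -> frame v (fun k => f (k + c)).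
Proof.
case=> fi fa ff fc; split.
- by move=> x y /fi /addIr.
- move=> w; rewrite fa; split=> -[k ->]; last by exists (k + c).
  by exists (k - c); rewrite subrK.
- by move=> k; rewrite addrAC; exact: ff.
- move=> k l /fc; rewrite -[k + c + 1]addrAC -[k + c - 1]addrAC.
  by case=> /addIr; [left|right].
Qed.

Lemma frame_opp v f : frame v f -> frame v (fun k => f (- k)).
Proof.
case=> fi fa ff fc; split.
- by move=> x y /fi /oppr_inj.
- move=> w; rewrite fa; split=> -[k ->]; last by exists (- k).
  by exists (- k); rewrite opprK.
- move=> k; rewrite face_swap23 opprD.
  by have := ff (- k - 1); rewrite subrK.
- move=> k l /fc [] h; [right|left]; apply: oppr_inj; rewrite h.
  + by rewrite opprB addrC.
  + by rewrite opprD.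
Qed.

Lemma Z7_ne2 (k : 'Z_7) : k + 1 + 1 <> k.
Proof.
by rewrite -addrA => /(congr1 (fun x => x - k)); rewrite addrAC subrr add0r.
Qed.

(** On the circle a link vertex has two neighbours, so the one already matched forces the other, and
    agreement propagates all the way around. *)
Lemma frame_eq v f g p : frame v f -> frame v g ->
  f p = g p -> f (p + 1) = g (p + 1) -> f = g.
Proof.
move=> [fi fa ff fc] [gi ga gf gc] e0 e1.
have step k : f k = g k -> f (k + 1) = g (k + 1) -> f (k + 1 + 1) = g (k + 1 + 1).
  move=> h0 h1.
  have /ga[l hl] : adj G v (f (k + 1 + 1)) by apply/fa; exists (k + 1 + 1).
  have := ff (k + 1); rewrite h1 hl => /gc[->//|].
  rewrite addrK => lk; move: hl; rewrite lk -h0 => /fi /Z7_ne2 [].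
have all n : f (p + n%:R) = g (p + n%:R) /\ f (p + n%:R + 1) = g (p + n%:R + 1).
  elim: n => [|n [IH1 IH2]]; first by rewrite addr0.
  by rewrite -natr1 addrA; split=> //; exact: step.
apply: funext => k; have [+ _] := all (k - p : 'Z_7).
by rewrite natr_Zp addrC subrK.
Qed.

Lemma frame_mem v f j : frame v f -> adj G v (f j).
Proof. by case=> _ fa _ _; apply/fa; exists j. Qed.

(* The two frames at a neighbour agree with the one at v on the common faces;
   orientation is carried over because positions run in opposite directions. *)
Lemma frame_transport v f j p g0 : frame v f -> frame (f j) g0 ->
  exists g, [/\ frame (f j) g, g p = v, g (p + 1) = f (j - 1) & g (p - 1) = f (j + 1)].
Proof.
move=> Ff Fg; have [fi fa ff fc] := Ff; have [gi ga gf gc] := Fg.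
have /ga[k vk] : adj G (f j) v by rewrite adj_sym; exact: frame_mem.
have nb l : face G v (f j) (f l) -> f l = g0 (k + 1) \/ f l = g0 (k - 1).
  move=> fl; have fl' : face G (f j) v (f l) by rewrite face_swap12.
  have /ga[m hm] : adj G (f j) (f l).
    by apply: (@face_adj _ G _ _ v); rewrite face_swap23.
  by move: fl'; rewrite {1}vk hm => /gc[] ->; [left|right].
have [u|u] : f (j - 1) = g0 (k + 1) \/ f (j - 1) = g0 (k - 1).
- by apply: nb; rewrite face_swap23; have := ff (j - 1); rewrite subrK.
- exists (fun x => g0 (x + (k - p))).
  have e : f (j + 1) = g0 (k - 1).
    case: (nb (j + 1)) => //; rewrite -u => /fi /(congr1 (fun x => x + 1)).
    by rewrite subrK => /Z7_ne2 [].
  split; first exact: frame_shift.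
  + by rewrite addrC subrK.
  + by rewrite u addrAC [p + _]addrC subrK.
  + by rewrite e addrAC [p + _]addrC subrK.
- exists (fun x => g0 (- x + (k + p))).
  have e : f (j + 1) = g0 (k + 1).
    case: (nb (j + 1)) => //; rewrite -u => /fi /(congr1 (fun x => x + 1)).
    by rewrite subrK => /Z7_ne2 [].
  split.
  + exact: (frame_opp (frame_shift (k + p) Fg)).
  + by rewrite addrC addrK.
  + by rewrite u; congr g0; ring.
  + by rewrite e; congr g0; ring.
Qed.

Lemma frame_exists v s : link_is_cycle G v s -> size s = 7%N -> exists f, frame v f.
Proof.
move=> [us _ sa sf] s7.
pose f (k : 'Z_7) := nth v s k.
have lt (k : 'Z_7) : (k < size s)%N by rewrite s7 ltn_ord.
have fin k : f k \in s by exact: mem_nth.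
have fi : injective f.
  by move=> x y /eqP; rewrite nth_uniq// => /eqP; exact: val_inj.
have nx k : next s (f k) = f (k + 1).
  rewrite next_nth fin /f index_uniq//.
  case: s s7 us {sa sf lt fin fi} @f => // x s [s6] us.
  rewrite /= modnDmr addn1.
  have := ltn_ord k; rewrite leq_eqVlt => /orP[/eqP[k6]|k6].
    (* At the last entry [next_nth] reads past the end, and its default value is the head of the
       cycle, which is position 0. *)
    by rewrite k6 /= nth_default// s6.
  by rewrite modn_small//=; apply: set_nth_default; rewrite s6.
exists f; split=> //.
- move=> w; rewrite sa; split=> [/(nthP v)[i]|[k ->//]].
  by rewrite s7 => i7 <-; exists (Ordinal i7).
- by move=> k; rewrite sf fin nx eqxx.
- move=> k l; rewrite sf => /andP[_ /orP[/eqP|/eqP]].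
    by rewrite nx => /fi; left.
  have : prev s (f k) = f (k - 1) by rewrite -{1}(subrK 1 k) -nx prev_next.
  by move=> -> /fi; right.
Qed.
End Frames.

(** * Continuation of germs along edge paths and trivial monodromy *)

Section Development.
Variables (V : choiceType) (G : complex2 V) (M : Type).
Variables (nbr : M -> 'Z_7 -> M) (back : M -> 'Z_7 -> 'Z_7).
Hypothesis nbr_inj : forall m, injective (nbr m).
Hypothesis nbr_back : forall m j,
  [/\ nbr (nbr m j) (back m j) = m,
      nbr (nbr m j) (back m j + 1) = nbr m (j - 1) &
      nbr (nbr m j) (back m j - 1) = nbr m (j + 1)].
Hypothesis frames : forall v, exists f, frame G v f.

(** A germ of a developing map: it sends [gpt] to [gimg], and [gfr j] to [nbr gimg j]. *)
Record germ := Germ { gpt : V; gimg : M; gfr : 'Z_7 -> V; gfrP : frame G gpt gfr }.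

Lemma germ_eq s t : gpt s = gpt t -> gimg s = gimg t -> gfr s = gfr t -> s = t.
Proof.
case: s => v m f p; case: t => v' m' f' p' /= e1 e2 e3.
by subst; congr Germ; exact: Prop_irrelevance.
Qed.

Definition germ_step (s : germ) (j : 'Z_7) (t : germ) : Prop :=
  let p := back (gimg s) j in
  [/\ gpt t = gfr s j, gimg t = nbr (gimg s) j, gfr t p = gpt s,
      gfr t (p + 1) = gfr s (j - 1) & gfr t (p - 1) = gfr s (j + 1)].

Definition germ_next s w t := exists2 j, w = gfr s j & germ_step s j t.

(** The fifth condition of [germ_step] is automatic: two consecutive values identify the frame of
    [t] with the transported one. *)
Lemma germ_stepI s j t : gpt t = gfr s j -> gimg t = nbr (gimg s) j ->
  gfr t (back (gimg s) j) = gpt s -> 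
  gfr t (back (gimg s) j + 1) = gfr s (j - 1) -> germ_step s j t.
Proof.
move=> h1 h2 h3 h4; split=> //.
have [g0 Fg0] := frames (gfr s j).
have [g [Fg gp gp1 gm1]] := frame_transport (back (gimg s) j) (gfrP s) Fg0.
rewrite -gm1; congr (_ _); apply: (frame_eq (p := back (gimg s) j)) _ Fg _ _.
- by rewrite -h1; exact: gfrP.
- by rewrite h3.
- by rewrite h4.
Qed.

Lemma germ_step_ex s j : exists t, germ_step s j t.
Proof.
have [g0 Fg0] := frames (gfr s j).
have [g [Fg gp gp1 gm1]] := frame_transport (back (gimg s) j) (gfrP s) Fg0.
by exists (Germ (nbr (gimg s) j) Fg).
Qed.

Lemma germ_step_det s j t t' : germ_step s j t -> germ_step s j t' -> t = t'.
Proof.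
move=> [a1 a2 a3 a4 _] [b1 b2 b3 b4 _]; apply: germ_eq; rewrite ?a1 ?a2//.
apply: (frame_eq (v := gpt t) (p := back (gimg s) j)); rewrite ?a3 ?a4//.
  exact: gfrP.
by rewrite a1 -b1; exact: gfrP.
Qed.

Lemma gfr_inj s : injective (gfr s).
Proof. by have [] := gfrP s. Qed.

Lemma germ_next_det s w t t' : germ_next s w t -> germ_next s w t' -> t = t'.
Proof.
move=> [j -> st] [j' /gfr_inj jj st']; rewrite -jj in st'.
exact: germ_step_det st st'.
Qed.

Lemma germ_next_ex s w : adj G (gpt s) w -> exists t, germ_next s w t.
Proof.
have [_ fa _ _] := gfrP s; move=> /fa[j ->].
by have [t st] := germ_step_ex s j; exists t; exists j.
Qed.

Lemma germ_next_pt s w t : germ_next s w t -> gpt t = w.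
Proof. by move=> [j wj [-> *]]. Qed.

Lemma germ_next_sym s w t : germ_next s w t -> germ_next t (gpt s) s.
Proof.
move=> [j _ [a1 a2 a3 a4 a5]].
have [n1 n2 n3] := nbr_back (gimg s) j.
have bk : back (gimg t) (back (gimg s) j) = j.
  apply: (@nbr_inj (gimg s)); have [] := nbr_back (gimg t) (back (gimg s) j).
  by rewrite a2 n1 => ->.
exists (back (gimg s) j); first by rewrite a3.
by apply: germ_stepI; rewrite ?a3 ?bk ?a5 ?a2 ?n1.
Qed.

(** Holonomy around a triangle is trivial: going to [y] through [x] or directly gives germs that
    agree on the edge from [x] to [gpt s] in the link of [y]. *)
Lemma germ_next_face s x t y u : face G (gpt s) x y ->
  germ_next s x t -> germ_next t y u -> germ_next s y u.
Proof.
move=> fxy [j xj [a1 a2 a3 a4 a5]] [k yk [b1 b2 b3 b4 b5]].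
set p := back (gimg s) j in a3 a4 a5.
set q := back (gimg t) k in b3 b4 b5.
have [n1 n2 n3] := nbr_back (gimg s) j.
have [o1 o2 o3] := nbr_back (gimg t) k.
have [_ fa _ fc] := gfrP s.
have /fa[l yl] : adj G (gpt s) y by apply: (@face_adj _ G _ _ x); rewrite face_swap23.
have [r1 r2 r3] := nbr_back (gimg s) l.
have inj m := @nbr_inj m.
exists l => //; move: fxy; rewrite {1}xj {1}yl => /fc[lj|lj].
- have kp : k = p - 1 by apply: (@gfr_inj t); rewrite -yk a5 -lj.
  have ul : gimg u = nbr (gimg s) l by rewrite b2 a2 kp n3 lj.
  have bq : back (gimg s) l = q - 1.
    by apply: (@nbr_inj (gimg u)); rewrite {1}ul r1 b2 o3 kp subrK a2 n1.
  apply: germ_stepI => //; first by rewrite b1 -yk.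
    by rewrite bq b5 kp subrK a3.
  by rewrite bq subrK b3 a1 lj addrK.
- have kp : k = p + 1 by apply: (@gfr_inj t); rewrite -yk a4 -lj.
  have ul : gimg u = nbr (gimg s) l by rewrite b2 a2 kp n2 lj.
  have bq : back (gimg s) l = q + 1.
    by apply: (@nbr_inj (gimg u)); rewrite {1}ul r1 b2 o2 kp addrK a2 n1.
  (* In this orientation the frame of [u] is known at the back position and the one before it, not
     the one after, so [u] is compared with the actual step. *)
  have [v [v1 v2 v3 v4 v5]] := germ_step_ex s l.
  have -> : u = v; last by [].
  apply: germ_eq; rewrite ?v1 ?v2 -?yl//.
    by rewrite b1 -yk.
  apply: (frame_eq (v := gpt u) (p := q)).
  + exact: gfrP.
  + by rewrite b1 -yk yl -v1; exact: gfrP.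
  + have -> : q = back (gimg s) l - 1 by rewrite bq addrK.
    by rewrite v5 bq addrK b3 a1 lj subrK.
  + by rewrite -bq v3 bq b4 kp addrK a3.
Qed.

Fixpoint lift (s : germ) (l : seq V) (t : germ) : Prop :=
  if l is w :: l' then exists2 u, germ_next s w u & lift u l' t else s = t.

Lemma lift_cat s l1 l2 t :
  lift s (l1 ++ l2) t <-> exists2 u, lift s l1 u & lift u l2 t.
Proof.
elim: l1 s => [|w l1 IH] s /=.
  by split=> [h|[u -> //]]; exists s.
split=> [[u su /IH[v uv vt]]|[v [u su uv] vt]].
  by exists v => //; exists u.
by exists u => //; apply/IH; exists v.
Qed.

Lemma lift_last s l t : lift s l t -> gpt t = last (gpt s) l.
Proof. by elim: l s => [s ->//|w l IH] s /= [u /germ_next_pt <-]; exact: IH. Qed.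

Lemma lift_det s l t t' : lift s l t -> lift s l t' -> t = t'.
Proof.
elim: l s => [s -> //|w l IH] s /= [u su ut] [u' su' ut'].
by rewrite (germ_next_det su' su) in ut'; exact: IH ut ut'.
Qed.

Lemma lift_ex s l : path (adj G) (gpt s) l -> exists t, lift s l t.
Proof.
elim: l s => [|w l IH] s /=; first by exists s.
case/andP=> /germ_next_ex[u su] pl.
have [|t ut] := IH u; first by rewrite (germ_next_pt su).
by exists t; exists u.
Qed.

Lemma lift_rev s l t : lift s l t -> lift t (rev (belast (gpt s) l)) s.
Proof.
elim: l s => [s ->//|w l IH] s /= [u su ut].
rewrite rev_cons -cats1; apply/lift_cat; exists u.
  by rewrite -(germ_next_pt su); exact: IH.
by exists s => //=; exact: germ_next_sym su.
Qed.

Definition lift_full (s : germ) (L : seq V) (t : germ) : Prop :=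
  if L is x :: l then gpt s = x /\ lift s l t else False.

Lemma lift_full_cat s p x q t :
  lift_full s (p ++ x :: q) t <-> exists2 u, lift_full s (p ++ [:: x]) u & lift u q t.
Proof.
case: p => [|a p] /=.
  by split=> [[h l]|[u [h <-] l]]; [exists s|].
rewrite -cat_rcons lift_cat -cats1; split=> [[h [u l1 l2]]|[u [h l1] l2]].
  by exists u.
by split=> //; exists u.
Qed.

Lemma lift_full_pt s p x u : lift_full s (p ++ [:: x]) u -> gpt u = x.
Proof.
case: p => [|a p] /= [h]; first by move=> <-.
by move=> /lift_last; rewrite last_cat.
Qed.

(** Spurs cancel because continuation is reversible, and faces because their holonomy is trivial;
    determinism does the rest. *)
Lemma lift_full_move s L L' t : homotopy_move G L L' ->
  lift_full s L t <-> lift_full s L' t.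
Proof.
case=> [p q x y axy|p q x y z fxyz]; rewrite lift_full_cat [X in _ <-> X]lift_full_cat.
  split=> -[u su ut]; exists u => //; have ux := lift_full_pt su.
    case: ut => v uv [w vw wt].
    have := germ_next_sym uv; rewrite ux => /germ_next_det /(_ vw) ->//.
  have [v uv] : exists v, germ_next u y v by apply: germ_next_ex; rewrite ux.
  exists v => //; exists u => //.
  by have := germ_next_sym uv; rewrite ux.
split=> -[u su /=]; have ux := lift_full_pt su; rewrite -ux in fxyz.
  move=> [v uv [w vw wt]]; exists u => //; exists w => //.
  exact: germ_next_face uv vw.
move=> [w uw wt]; exists u => //.
have [v uv] := germ_next_ex (face_adj fxyz).
have vz : adj G (gpt v) z.
  rewrite (germ_next_pt uv); apply: (@face_adj _ G _ _ (gpt u)).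
  by rewrite face_swap23 face_swap12.
have [w' vw'] := germ_next_ex vz.
exists v => //; exists w' => //.
by rewrite (germ_next_det (germ_next_face fxyz uv vw') uw).
Qed.

Lemma lift_full_homotopic s L L' t : homotopic G L L' ->
  lift_full s L t <-> lift_full s L' t.
Proof.
elim=> [||x y _|x y z _ h1 _ h2] //; first by move=> x y /lift_full_move.
  by move=> ->.
by rewrite h1.
Qed.

Hypothesis G_sc : simply_connected G.

Lemma lift_closed s l t : walk G (gpt s) (gpt s) l -> lift s l t -> s = t.
Proof.
move=> wl st; have h := lift_full_homotopic s t (G_sc.2 _ _ wl).
by have /h[] : lift_full s (gpt s :: l) t by [].
Qed.

Lemma development (v0 : V) (m0 : M) : exists (m : V -> M) (F : V -> 'Z_7 -> V),
  forall v, frame G v (F v) /\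
    forall j, [/\ m (F v j) = nbr (m v) j, F (F v j) (back (m v) j) = v,
                F (F v j) (back (m v) j + 1) = F v (j - 1) &
                F (F v j) (back (m v) j - 1) = F v (j + 1)].
Proof.
have [f0 Ff0] := frames v0.
pose s0 := Germ m0 Ff0.
have path_lift s l t : lift s l t -> path (adj G) (gpt s) l.
  elim: l s => //= w l IH s [u su /IH]; rewrite (germ_next_pt su) => ->.
  by case: su => j -> _; rewrite (frame_mem _ (gfrP s)).
(* Monodromy: [l] followed by the reverse of [l'] is a closed walk, so its lift returns to [s0]. The
   germ at a vertex then depends only on the vertex. *)
have uniq_end l l' t t' : lift s0 l t -> lift s0 l' t' -> gpt t = gpt t' -> t = t'.
  move=> st st' tt'.
  have [r t'r] : exists r, lift t (rev (belast v0 l')) r.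
    apply: lift_ex; rewrite tt' (lift_last st') rev_path.
    under eq_path do rewrite adj_sym.
    exact: path_lift st'.
  have s0r : s0 = r.
    apply: (@lift_closed s0 (l ++ rev (belast v0 l'))); last first.
      by apply/lift_cat; exists t.
    split; first by apply: (path_lift _ _ r); apply/lift_cat; exists t.
    rewrite last_cat -(lift_last st) tt' (lift_last st').
    by case: (l') => //= a l2; rewrite rev_cons last_rcons.
  rewrite -s0r in t'r; have := lift_rev t'r; rewrite tt' => h.
  exact: lift_det h (lift_rev (lift_rev st')).
have ex v : exists t, gpt t = v /\ exists l, lift s0 l t.
  have [l [pl ll]] := G_sc.1 v0 v.
  have [t st] := @lift_ex s0 l pl.
  by exists t; split; [rewrite (lift_last st)|exists l].
pose g v := projT1 (cid (ex v)).
have gP v : gpt (g v) = v /\ exists l, lift s0 l (g v) by rewrite /g; case: cid.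
exists (fun v => gimg (g v)), (fun v => gfr (g v)) => v.
have [gv [l lv]] := gP v; split; first by rewrite -{1}gv; exact: gfrP.
move=> j; have [t st] := germ_step_ex (g v) j.
have [gw [l' lw]] := gP (gfr (g v) j).
have tw : t = g (gfr (g v) j).
  apply: (uniq_end (l ++ [:: gfr (g v) j]) l') => //.
    by apply/lift_cat; exists (g v) => //=; exists t => //; exists j.
  by rewrite gw; case: st.
by case: st; rewrite tw gv.
Qed.
End Development.

(** * Classes of vertices and the transfer inequality *)

(* The data around a vertex (n, i) that determine the classes of its neighbours.
   Writing q = par i: nb_letter and nb_parent tell whether letters i and q are b;
   the other fields are, for a letter b, the letters q - 1, par q and par (q - 1),
   and for a letter a, the letters i - 1, par q and q + 1. *)
Record nbhd := Nbhd {
  nb_letter : bool; nb_parent : bool; nb_left : bool; nb_above : bool; nb_side : bool }.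

(** Two letters b are never adjacent, and an a whose parent is b directly follows a b. *)
Definition nbhd_ok (c : nbhd) : bool :=
  let: Nbhd b q x _ t := c in if b then ~~ (q && x) else (q ==> x) && ~~ (q && t).

(** A class records whether the letter and its parent are b. For a letter a, [last] tells whether it
    ends the image of its parent. *)
Definition nbhd_class (c : nbhd) (j : nat) : bool * bool :=
  let: Nbhd b q x z t := c in
  let last := q || ~~ x in
  nth (false, false)
    (if b then [:: (x, t); (false, x); (true, true); (false, true); (true, false);
                   (false, q); (q, z)]
     else [:: (q, z); (x, q); (true, false); (false, false); (false, false);
              (true, last); if last then (true, t) else (false, q)]) j.

Definition nbhd_back (c : nbhd) (j : nat) : nat :=
  let: Nbhd b _ x _ _ := c in
  nth 0%N
    (if b then [:: if x then 4 else 5; 6; 6; 0; 0; 1; 2]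
     else [:: if x then 3 else 4; if x then 5 else 6; 6; 0; 0; 0; 1])%N j.

Definition level_change (b : bool) (j : nat) : int :=
  nth 0 (if b then [:: -1; 0; 1; 1; 1; 0; -1] else [:: -1; 0; 1; 1; 1; 1; 0]) j.

(* 6 * (2/3) ^ level_change b j *)
Definition level_weight (b : bool) (j : nat) : nat :=
  nth 0%N (if b then [:: 9; 6; 4; 4; 4; 6; 9] else [:: 9; 6; 4; 4; 4; 4; 6])%N j.

(* A rounded Perron eigenvector, computed numerically. It is indexed by the class
   of the current vertex, the position of the previous vertex in its link, and
   the last turn (0: other, 1: first position on one side, 2: on the other). *)
Definition potential_table : seq (seq (seq N)) :=
  [::
     [:: [:: 214; 178; 176]; [:: 274; 249; 183]; [:: 300; 277; 251]; [:: 309; 286; 277];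
         [:: 309; 277; 286]; [:: 300; 251; 277]; [:: 274; 183; 249]];
     [:: [:: 222; 175; 175]; [:: 283; 258; 183]; [:: 323; 300; 262]; [:: 332; 309; 300];
         [:: 332; 300; 309]; [:: 323; 262; 300]; [:: 283; 183; 258]];
     [:: [:: 264; 228; 187]; [:: 336; 312; 236]; [:: 363; 340; 312]; [:: 370; 340; 340];
         [:: 363; 314; 340]; [:: 338; 250; 313]; [:: 281; 189; 245]];
     [:: [:: 281; 245; 189]; [:: 338; 313; 250]; [:: 363; 340; 314]; [:: 370; 340; 340];
         [:: 363; 312; 340]; [:: 336; 236; 312]; [:: 264; 187; 228]]]%num.

Definition potential (cl : bool * bool) (p mem : nat) : N :=
  nth 0%num (nth [::] (nth [::] potential_table (2 * cl.1 + cl.2)) p) mem.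

(** Turns are counted from the position of the previous vertex: 0 would backtrack, while 1 and 6
    lead to the neighbours common to both ends of the last edge. *)
Definition turns (mem : nat) : seq nat :=
  (match mem with
   | 0 => [:: 1; 2; 3; 4; 5; 6]
   | 1 => [:: 2; 3; 4; 5; 6]
   | _ => [:: 1; 2; 3; 4; 5] end)%N.

Definition turn_mem (t : nat) : nat := (match t with 1 => 1 | 6 => 2 | _ => 0 end)%N.

Definition potential_term (c : nbhd) (p t : nat) : N :=
  let j := ((p + t) %% 7)%N in
  (N.of_nat (level_weight (nb_letter c) j) *
   potential (nbhd_class c j) (nbhd_back c j) (turn_mem t))%num.

(** The ratio 768/25 is 6 times 5.12, the 6 coming from the scaling of [level_weight]. *)
Definition potential_check (c : nbhd) : bool :=
  nbhd_ok c ==> all (fun p => all (fun mem =>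
      (25 * foldr (fun t a => potential_term c p t + a) 0 (turns mem)
        <=? 768 * potential (nb_letter c, nb_parent c) p mem)%num)
    (iota 0 3)) (iota 0 7).

Lemma potential_checked c : potential_check c.
Proof. by case: c => -[] [] [] [] []; vm_compute. Qed.

Lemma potential_ineq c p mem : nbhd_ok c -> (p < 7)%N -> (mem < 3)%N ->
  (25 * \sum_(t <- turns mem) N.to_nat (potential_term c p t)
    <= 768 * N.to_nat (potential (nb_letter c, nb_parent c) p mem))%N.
Proof.
move=> ok p7 m3; have := potential_checked c.
rewrite /potential_check ok => /allP /(_ p); rewrite mem_iota => /(_ p7).
move=> /allP /(_ mem); rewrite mem_iota => /(_ m3).
set g := potential_term c p.
have -> : (\sum_(t <- turns mem) N.to_nat (g t))%N =
    N.to_nat (foldr (fun t a => (g t + a)%num) 0%num (turns mem)).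
  elim: (turns mem) => [|t s IH]; first by rewrite big_nil.
  by rewrite big_cons IH /=; lia.
by move: (foldr _ _ _) (potential _ _ _) => a b /N.leb_le; lia.
Qed.

Lemma potential_bounds (cl : bool * bool) p mem : (p < 7)%N -> (mem < 3)%N ->
  (1 <= N.to_nat (potential cl p mem) <= 370)%N.
Proof.
case: cl => -[] []; do 7?[case: p => [|p]] => //; do 3?[case: mem => [|mem]] => //;
  by vm_compute.
Qed.

Section Classes.
Variable W : substitution_word.
Local Notation B := (isb W).
Local Notation phi := (phi W).
Local Notation par := (par W).

Definition nbhd_of (m : int * int) : nbhd :=
  let i := m.2 in let q := par i in
  if B i then Nbhd true (B q) (B (q - 1)) (B (par q)) (B (par (q - 1)))
  else Nbhd false (B q) (B (i - 1)) (B (par q)) (B (q + 1)).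

Definition level_class (m : int * int) := (B m.2, B (par m.2)).

Lemma level_class_nbhd m :
  level_class m = (nb_letter (nbhd_of m), nb_parent (nbhd_of m)).
Proof. by rewrite /level_class /nbhd_of; case: ifP. Qed.

Lemma isb_succ q : B q -> B (q + 1) = false.
Proof. by move=> /phi_par {1}<-; exact: isb_inner. Qed.

Lemma isb_pred q : B q -> B (q - 1) = false.
Proof. by move=> bq; apply/negP => /isb_succ; rewrite subrK bq. Qed.

Lemma nbhd_ofP m : nbhd_ok (nbhd_of m).
Proof.
case: m => n i; rewrite /nbhd_of /=; case: (wordP W i) => q.
- by move=> bi _ ->; rewrite bi /=; apply/negP => /andP[/isb_pred ->].
- move=> bq /negbTE bi iq ->; rewrite bi /= bq (isb_succ bq).
  by rewrite iq addrK isb_phi.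
- by move=> /negbTE bq /negbTE bi iq ->; rewrite bi /= bq.
- by move=> /negbTE bq /negbTE bi iq ->; rewrite bi /= bq.
Qed.

(** This reduces the transfer operator on the infinite tiling to the finitely many cases of
    [nbhd]. *)
Lemma level_class_nbr m (j : 'Z_7) :
  level_class (level_nbr W m j) = nbhd_class (nbhd_of m) j.
Proof.
case: m => n i; rewrite /level_nbr /nbhd_of /level_class /=.
case: (wordP W i) => q.
- move=> bi iq pi.
  case: j => -[|[|[|[|[|[|[|//]]]]]]] lt; rewrite bi pi //=.
  + by rewrite iq isb_pred_phi par_pred_phi.
  + by rewrite isb_phi par_phi bi.
  + by rewrite isb_inner par_inner bi.
  + have -> : phi i + 2 = phi (i + 1) by rewrite phi_succ bi.
    by rewrite isb_phi par_phi isb_succ.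
  + by rewrite iq isb_inner par_inner.
- move=> bq /negbTE bi iq pi.
  have b1 : B (i - 1) by rewrite iq addrK isb_phi.
  have p1 : par (i - 1) = q by rewrite iq addrK par_phi.
  have i1 : i + 1 = phi (q + 1) by rewrite phi_succ bq; lia.
  case: j => -[|[|[|[|[|[|[|//]]]]]]] lt; rewrite bi pi b1 bq //=.
  + by rewrite p1 ?b1 ?bq.
  + by rewrite isb_phi par_phi bi.
  + by rewrite isb_inner par_inner bi.
  + by rewrite isb_inner2 ?bi// par_inner2 ?bi.
  + have -> : phi i + 3 = phi (i + 1) by rewrite phi_succ bi.
    by rewrite isb_phi par_phi i1 isb_phi.
  + by rewrite i1 isb_phi par_phi.
- move=> bq /negbTE bi iq pi.
  have b1 : B (i - 1) by rewrite iq addrK isb_phi.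
  have p1 : par (i - 1) = q by rewrite iq addrK par_phi.
  have i1 : i + 1 = phi q + 2 by lia.
  have bS : B (i + 1) = false by rewrite i1 isb_inner2.
  have pS : par (i + 1) = q by rewrite i1 par_inner2.
  case: j => -[|[|[|[|[|[|[|//]]]]]]] lt; rewrite bi pi b1 (negbTE bq) //=.
  + by rewrite p1 ?b1 ?(negbTE bq).
  + by rewrite isb_phi par_phi bi.
  + by rewrite isb_inner par_inner bi.
  + by rewrite isb_inner2 ?bi// par_inner2 ?bi.
  + have -> : phi i + 3 = phi (i + 1) by rewrite phi_succ bi.
    by rewrite isb_phi par_phi bS.
  + by rewrite bS pS (negbTE bq).
- move=> bq /negbTE bi iq pi.
  have i0 : i - 1 = phi q + 1 by lia.
  have b1 : B (i - 1) = false by rewrite i0 isb_inner.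
  have p1 : par (i - 1) = q by rewrite i0 par_inner.
  have i1 : i + 1 = phi (q + 1) by rewrite phi_succ (negbTE bq); lia.
  case: j => -[|[|[|[|[|[|[|//]]]]]]] lt; rewrite bi pi b1 (negbTE bq) //=.
  + by rewrite p1 ?b1 ?(negbTE bq).
  + by rewrite isb_phi par_phi bi.
  + by rewrite isb_inner par_inner bi.
  + by rewrite isb_inner2 ?bi// par_inner2 ?bi.
  + have -> : phi i + 3 = phi (i + 1) by rewrite phi_succ bi.
    by rewrite isb_phi par_phi i1 isb_phi.
  + by rewrite i1 isb_phi par_phi.
Qed.

Lemma level_back_nbhd m (j : 'Z_7) :
  level_back W m j = nbhd_back (nbhd_of m) j :> nat.
Proof.
case: m => n i; rewrite /level_back /nbhd_of /=.
case: j => -[|[|[|[|[|[|[|//]]]]]]] lt; case: (B i) => //=;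
  by case: (B _).
Qed.

Lemma level_nbr_fst m (j : 'Z_7) :
  (level_nbr W m j).1 = m.1 + level_change (nb_letter (nbhd_of m)) j.
Proof.
case: m => n i; rewrite /level_nbr /nbhd_of /=.
by case: j => -[|[|[|[|[|[|[|//]]]]]]] lt; case: (B i) => //=; rewrite addr0.
Qed.
End Classes.

(** * Counting walks *)

Section StateWalks.
Variables (V : choiceType) (S : eqType) (step : S -> seq (V * S)).

Fixpoint state_walks (n : nat) (s : S) : seq (seq V) :=
  if n is n'.+1 then [seq x.1 :: p | x <- step s, p <- state_walks n' x.2]
  else [:: [::]].

Lemma sum_state_walksS (R : nmodType) n s (g : seq V -> R) :
  \sum_(p <- state_walks n.+1 s) g p =
  \sum_(x <- step s) \sum_(p <- state_walks n x.2) g (x.1 :: p).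
Proof. exact: big_allpairs_dep. Qed.

Lemma state_walks_uniq n s :
  (forall s, uniq [seq x.1 | x <- step s]) -> uniq (state_walks n s).
Proof.
move=> us; elim: n s => [//|n IH] s /=.
have := us s; elim: (step s) => [//|x l IHl] /= /andP[xl ul].
rewrite cat_uniq map_inj_uniq ?IH//=; last by move=> p q [].
rewrite (IHl ul) andbT; apply/hasPn => p /allpairsPdep[y [q [yl _ ->]]].
apply/negP => /mapP[q' _ [yx _]]; move/negP: xl; apply.
by rewrite -yx; apply/mapP; exists y.
Qed.

Variable R : realFieldType.

(** The one-step inequality is iterated, and the bound [C] on the final weights turns their sum into
    a count. *)
Lemma size_state_walks_ge (w : S -> R) (L C : R) n s : 0 <= L ->
  (forall s, w s <= C) -> (forall s, L * w s <= \sum_(x <- step s) w x.2) ->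
  L ^+ n * w s <= C * (size (state_walks n s))%:R.
Proof.
move=> L0 wC wL; rewrite -sum1_size natr_sum.
elim: n s => [|n IH] s; first by rewrite mul1r big_seq1 mulr1.
rewrite sum_state_walksS exprSr -mulrA.
apply: le_trans (ler_wpM2l (exprn_ge0 n L0) (wL s)) _.
by rewrite !mulr_sumr; apply: ler_sum => x _; exact: IH.
Qed.

Lemma sum_state_walks_le (pt : S -> V) (e : V -> R) (w : S -> R) (L c : R) n s :
  0 <= L -> (forall s, c * e (pt s) <= w s) ->
  (forall s x, x \in step s -> pt x.2 = x.1) ->
  (forall s, \sum_(x <- step s) w x.2 <= L * w s) ->
  c * \sum_(p <- state_walks n s) e (last (pt s) p) <= L ^+ n * w s.
Proof.
move=> L0 cw ptS wL; elim: n s => [|n IH] s; first by rewrite big_seq1 mul1r; exact: cw.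
rewrite sum_state_walksS exprSr -mulrA.
apply: le_trans (ler_wpM2l (exprn_ge0 n L0) (wL s)).
rewrite !mulr_sumr big_seq [leRHS]big_seq; apply: ler_sum => x xs.
by rewrite /= -(ptS s x xs); exact: IH.
Qed.
End StateWalks.

(** * The two transfer-matrix estimates on the developed graph *)

Section LevelStructure.
Variables (V : choiceType) (G : complex2 V) (W : substitution_word).
Variables (m : V -> int * int) (F : V -> 'Z_7 -> V).
Hypothesis F_frame : forall v, frame G v (F v).
Hypothesis m_F : forall v j, m (F v j) = level_nbr W (m v) j.
Hypothesis F_back : forall v j,
  [/\ F (F v j) (level_back W (m v) j) = v,
      F (F v j) (level_back W (m v) j + 1) = F v (j - 1) &
      F (F v j) (level_back W (m v) j - 1) = F v (j + 1)].

Lemma adj_F v w : adj G v w <-> exists j, w = F v j.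
Proof. by have [] := F_frame v. Qed.

Lemma F_inj v : injective (F v).
Proof. by have [] := F_frame v. Qed.

(* The second component of a state remembers the direction of the current
   horizontal run (Some true: right, Some false: left). *)
Definition forward_turns (b : bool) (d : option bool) : seq ('Z_7 * option bool) :=
  [seq (inZp j, None) | j <- if b then [:: 2; 3; 4]%N else [:: 2; 3; 4; 5]%N] ++
  (if d != Some false then [:: (inZp (if b then 5 else 6)%N, Some true)] else [::]) ++
  (if d != Some true then [:: (inZp 1, Some false)] else [::]).

Definition forward_step (s : V * option bool) : seq (V * (V * option bool)) :=
  [seq (F s.1 x.1, (F s.1 x.1, x.2)) | x <- forward_turns (isb W (m s.1).2) s.2].

(** The region still open to a forward walk at [a] with run direction [d]: all higher levels, and
    the allowed sides of its own level. *)
Definition ahead (d : option bool) (a b : int * int) : bool :=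
  (a.1 < b.1) || (a.1 == b.1) &&
    ((d != Some false) && (a.2 < b.2) || (d != Some true) && (b.2 < a.2)).

Lemma ahead_step v d x b : x \in forward_turns (isb W (m v).2) d ->
  (m (F v x.1) == b) || ahead x.2 (m (F v x.1)) b -> ahead d (m v) b.
Proof.
rewrite m_F /forward_turns /ahead /level_nbr /level_link.
case: (m v) b => n i [n' i'] /=.
rewrite !mem_cat => /orP[/mapP[j]|/orP[]].
- by case: ifP => bi; rewrite !inE; (do ?case/orP); move=> /eqP -> -> /=;
    rewrite xpair_eqE; lia.
- by case: d => [[]|] //; rewrite inE => /eqP -> /=; case: ifP => bi /=;
    rewrite xpair_eqE; lia.
- by case: d => [[]|] //; rewrite inE => /eqP -> /=; case: ifP => bi /=;
    rewrite xpair_eqE; lia.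
Qed.

(** Every later vertex has its image ahead of the current one, and [ahead] is irreflexive, so no
    vertex recurs. *)
Lemma forward_walksP n s p : p \in state_walks forward_step n s ->
  [/\ path (adj G) s.1 p, uniq (s.1 :: p), size p = n &
      all (fun v => ahead s.2 (m s.1) (m v)) p].
Proof.
elim: n s p => [|n IH] [v d] p; first by rewrite inE => /eqP ->.
move=> /allpairsPdep[_ [q [/mapP[x xt ->] /IH[/= pq uq <- aq] ->]]].
have ah : all (fun u => ahead d (m v) (m u)) (F v x.1 :: q).
  apply/allP => u; rewrite inE => /orP[/eqP ->|uq'].
    by apply: (ahead_step xt); rewrite eqxx.
  by apply: (ahead_step xt); rewrite (allP aq u uq') orbT.
split=> //.
- by rewrite /= pq andbT; apply/adj_F; exists x.1.
- rewrite cons_uniq uq andbT; apply/negP => /(allP ah).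
  by rewrite /ahead !ltxx !andbF.
Qed.

Lemma forward_step_uniq s : uniq [seq x.1 | x <- forward_step s].
Proof.
rewrite -map_comp; have -> : [eta fst] \o (fun x => (F s.1 x.1, (F s.1 x.1, x.2))) =
  F s.1 \o (fun x : 'Z_7 * option bool => x.1) by [].
rewrite map_comp map_inj_uniq; last exact: F_inj.
by rewrite /forward_turns; case: s => v [[]|] /=; case: isb.
Qed.

Variable R : realFieldType.

(* A vector found numerically, multiplied by at least 5.13 by the transfer operator. *)
Definition forward_weight (s : V * option bool) : R :=
  if isb W (m s.1).2 then (if s.2 is None then 92 else 74)
  else (if s.2 is None then 106 else 91).

(** A finite check through [nbhd_class]. For a letter b outside a run it is nearly sharp: 471.96
    against 472. *)
Lemma forward_weight_ineq s :
  513 / 100 * forward_weight s <= \sum_(x <- forward_step s) forward_weight x.2.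
Proof.
case: s => v d; rewrite big_map /forward_weight /=.
have cl (j : 'Z_7) : isb W (m (F v j)).2 = (nbhd_class (nbhd_of W (m v)) j).1.
  by rewrite m_F -level_class_nbr.
under eq_bigr do rewrite cl.
have := nbhd_ofP W (m v).
have -> : isb W (m v).2 = nb_letter (nbhd_of W (m v)).
  by rewrite /nbhd_of; case: ifP.
case: (nbhd_of _ _) => -[] q x z t; rewrite /forward_turns.
- by case: d => [[]|] _ /=; rewrite !(big_cons, big_nil) /=; lra.
- by case: d => [[]|]; case: q; case: x; rewrite //= => _;
    rewrite !(big_cons, big_nil) /=; lra.
Qed.

(** The initial weight is at least 92 and all weights are at most 106, whose ratio is below 2. *)
Lemma forward_walks_many n o :
  (513 / 100) ^+ n <= 2 * (size (state_walks forward_step n (o, None)))%:R :> R.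
Proof.
have := @size_state_walks_ge _ _ forward_step R forward_weight (513 / 100) 106 n (o, None).
have h : (0 <= 513 / 100 :> R) by lra.
have h1 s : forward_weight s <= 106.
  by rewrite /forward_weight; case: ifP => _; case: s.2 => [d|]; rewrite ler_nat.
move=> /(_ h h1 forward_weight_ineq).
have : 92 <= forward_weight (o, None).
  by rewrite /forward_weight /=; case: ifP => _; rewrite ler_nat.
have := exprn_ge0 n h.
set L := _ ^+ n; set N := _%:R; move=> L0 w1.
by have := ler_wpM2l L0 w1; lra.
Qed.
(* The state (v, p, mem): current vertex, position of the previous vertex in its
   link, and memory of the last turn. *)
Definition turn_state (v : V) (j : 'Z_7) (mem : nat) : V * 'Z_7 * nat :=
  (F v j, level_back W (m v) j, mem).

Definition turn_step (s : V * 'Z_7 * nat) : seq (V * (V * 'Z_7 * nat)) :=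
  let: (v, p, mem) := s in
  [seq (F v (inZp (p + t)), turn_state v (inZp (p + t)) (turn_mem t)) | t <- turns mem].

(* In a self-avoiding walk two consecutive extreme turns on the same side would
   close a triangle. *)
Lemma mem_turn_walks n (s : V * 'Z_7 * nat) q : let: (v, p, mem) := s in
  [/\ path (adj G) v q, uniq (v :: q) & size q = n] ->
  F v p \notin q -> (mem = 1%N -> F v (p + 1) \notin q) ->
  ((1 < mem)%N -> F v (p - 1) \notin q) ->
  q \in state_walks turn_step n s.
Proof.
elim: n q s => [|n IH] [|w q] [[v p] mem] [] //= /andP[vw pq].
rewrite !inE !negb_or => /andP[/andP[vnw vq] /andP[wq uq]] [sq].
move=> /andP[pw npq] h1 h2.
have [j wj] : exists j, w = F v j by apply/adj_F.
have jp : j <> p by move=> jp; move: pw; rewrite wj jp eqxx.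
pose d : 'Z_7 := j - p; pose t : nat := d.
have t7 : (t < 7)%N := ltn_ord d.
have tE : inZp (p + t) = j :> 'Z_7.
  by have -> : inZp (p + t) = p + d; [exact: val_inj | rewrite addrC subrK].
have dt k : t = k -> j = p + inZp k.
  move=> tk; rewrite -tk valZpK addrC /d subrK//.
have t0 : t <> 0%N by move=> /dt jE; apply: jp; rewrite jE -[RHS]addr0;
  congr (_ + _); exact: val_inj.
have t1 : t = 1%N -> j = p + 1 by move=> /dt ->; congr (_ + _); exact: val_inj.
have t6 : t = 6%N -> j = p - 1 by move=> /dt ->; congr (_ + _); exact: val_inj.
have [b1 b2 b3] := F_back v j.
apply/allpairsPdep; exists (F v j, turn_state v j (turn_mem t)), q; split=> //=.
- apply/mapP; exists t; last by rewrite tE.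
  case: mem h1 h2 => [|[|mem]] /= h1 h2; rewrite !inE.
  + by move: t0 t7; case: (t) => [|[|[|[|[|[|[|]]]]]]].
  + have : t <> 1%N by move=> /t1 jE; have := h1 erefl; rewrite wj jE eqxx.
    by move: t0 t7; case: (t) => [|[|[|[|[|[|[|]]]]]]].
  + have : t <> 6%N by move=> /t6 jE; have := h2 erefl; rewrite wj jE eqxx.
    by move: t0 t7; case: (t) => [|[|[|[|[|[|[|]]]]]]].
- apply: (IH q (turn_state v j (turn_mem t))).
  + by rewrite -wj /= pq wq uq.
  + by rewrite b1.
  + move=> e; rewrite b2 t1 ?addrK//.
    by move: e; rewrite /turn_mem; case: (t) => [|[|[|[|[|[|[|]]]]]]].
  + move=> e; rewrite b3 t6 ?subrK//.
    by move: e; rewrite /turn_mem; case: (t) => [|[|[|[|[|[|[|]]]]]]].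
- by rewrite wj.
Qed.

Definition height_weight (v : V) : R := (2 / 3) ^ (m v).1.

Lemma height_weight_gt0 v : 0 < height_weight v.
Proof. by apply: exprz_gt0; lra. Qed.

Lemma height_weight_F v j :
  height_weight (F v j) =
  height_weight v * ((level_weight (nb_letter (nbhd_of W (m v))) j)%:R / 6).
Proof.
rewrite /height_weight m_F level_nbr_fst expfzDr; last by apply/negP => /eqP; lra.
congr (_ * _); rewrite /level_change /level_weight.
by case: j => -[|[|[|[|[|[|[|//]]]]]]] lt; case: nb_letter => /=;
  rewrite ?expr0z ?expr1z ?exprN1 ?invf_div; lra.
Qed.

(** The truncation matches [turns], which treats every memory above 2 like 2. *)
Definition turn_weight (s : V * 'Z_7 * nat) : R :=
  let: (v, p, mem) := s in
  height_weight v * (N.to_nat (potential (level_class W (m v)) p (minn mem 2)))%:R.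

Lemma turn_weight_ineq s :
  \sum_(x <- turn_step s) turn_weight x.2 <= 512 / 100 * turn_weight s.
Proof.
case: s => [[v p] mem]; rewrite big_map /=.
have [mem' m3 [-> ->]] : exists2 k, (k < 3)%N & minn mem 2 = k /\ turns mem = turns k.
  by case: mem => [|[|mem]]; [exists 0%N|exists 1%N|exists 2%N]; rewrite // minnSS minnSS minn0.
have := potential_ineq (nbhd_ofP W (m v)) (ltn_ord p) m3.
rewrite level_class_nbhd -(ler_nat R) !natrM natr_sum.
set c := nbhd_of W (m v); set P := (N.to_nat (potential _ p mem'))%:R => h.
have -> : \sum_(t <- turns mem') turn_weight (turn_state v (inZp (p + t)) (turn_mem t)) =
  height_weight v / 6 * \sum_(t <- turns mem') (N.to_nat (potential_term c p t))%:R.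
  rewrite mulr_sumr; apply: eq_bigr => t _.
  have mt : minn (turn_mem t) 2 = turn_mem t.
    by rewrite /turn_mem; case: t => [|[|[|[|[|[|[|]]]]]]].
  rewrite /turn_weight /turn_state mt height_weight_F.
  rewrite m_F level_class_nbr level_back_nbhd /potential_term N2Nat.inj_mul Nat2N.id natrM.
  have -> : (inZp (p + t) : 'Z_7) = ((p + t) %% 7)%N :> nat by [].
  by rewrite -/c; ring.
have := height_weight_gt0 v; move: h.
set S := \sum_(t <- _) _; set H := height_weight v => h H0.
by have := ler_wpM2l (ltW H0) h; lra.
Qed.

Lemma turn_walks_few n s :
  \sum_(q <- state_walks turn_step n s) height_weight (last s.1.1 q)
    <= (512 / 100) ^+ n * (370 * height_weight s.1.1).
Proof.
have bd (s' : V * 'Z_7 * nat) :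
    height_weight s'.1.1 <= turn_weight s' <= 370 * height_weight s'.1.1.
  case: s' => [[v p] mem] /=; have H0 := height_weight_gt0 v.
  have m3 : (minn mem 2 < 3)%N by lia.
  have /andP[p1 p2] := potential_bounds (level_class W (m v)) (ltn_ord p) m3.
  apply/andP; split; first by rewrite ler_peMr ?(ltW H0)// ler1n.
  by rewrite mulrC ler_pM2r// ler_nat.
have L0 : 0 <= 512 / 100 :> R by lra.
have := @sum_state_walks_le V _ turn_step R (fun s => s.1.1) height_weight
  turn_weight (512 / 100) 1 n s L0.
rewrite mul1r => h; apply: le_trans (h _ _ turn_weight_ineq) _.
- by move=> s'; rewrite mul1r; case/andP: (bd s').
- by move=> [[v p] mem] x /mapP[t _ ->].
- by apply: ler_wpM2l; [exact: exprn_ge0|case/andP: (bd s)].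
Qed.

(** A step raises the height by at most one. Along a geodesic this bounds (2/3) to the power of the
    distance by a ratio of height weights. *)
Lemma height_weight_path v q : path (adj G) v q ->
  height_weight v * (2 / 3) ^+ size q <= height_weight (last v q).
Proof.
elim: q v => [|w q IH] v /=; first by rewrite mulr1.
move=> /andP[/adj_F[j ->] /IH]; apply: le_trans.
rewrite exprS mulrA ler_pM2r ?exprn_gt0//; last by lra.
rewrite height_weight_F ler_pM2l ?height_weight_gt0//.
rewrite /level_weight.
case: j => -[|[|[|[|[|[|[|//]]]]]]] lt; case: nb_letter => /=; lra.
Qed.
End LevelStructure.

Section Distance.
Variables (V : choiceType) (G : complex2 V).
Hypothesis G_conn : connected_graph G.

(** Connectedness provides a shortest walk, so the default value of [xget] is excluded. *)
Lemma graph_distP x y : is_dist G x y (graph_dist G x y).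
Proof.
rewrite /graph_dist; case: xgetP => [k -> //|none].
have [p pP] := G_conn x y.
have ex : exists k, `[< exists2 p, walk G x y p & size p = k >].
  by exists (size p); apply/asboolP; exists p.
case: (ex_minnP ex) => k /asboolP kP kmin; exfalso; apply: (none k).
by split=> // q qP; apply: kmin; apply/asboolP; exists q.
Qed.

Lemma graph_dist_gt0 x y : x != y -> (0 < graph_dist G x y)%N.
Proof.
move=> xy; have [[p [_ pl] ps] _] := graph_distP x y.
by rewrite -ps; case: p pl {ps} => //= xy'; rewrite xy' eqxx in xy.
Qed.
End Distance.

(** * Displacement *)

Lemma ler_sum_uniq (R : realFieldType) (T : eqType) (s l : seq T) (g : T -> R) :
  uniq s -> {subset s <= l} -> (forall x, 0 <= g x) ->
  \sum_(x <- s) g x <= \sum_(x <- l) g x.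
Proof.
move=> us sl g0; elim: s l us sl => [|x s IH] l /=.
  by move=> _ _; rewrite big_nil; apply: sumr_ge0.
move=> /andP[xs us] sl; have xl : x \in l by apply: sl; rewrite mem_head.
rewrite big_cons (perm_big _ (perm_to_rem xl)) big_cons lerD2l; apply: IH => // y ys.
have : y \in x :: rem x l
  by rewrite -(perm_mem (perm_to_rem xl)); apply: sl; rewrite inE ys orbT.
by rewrite inE => /orP[/eqP yx|//]; rewrite -yx ys in xs.
Qed.

Lemma level_development (V : choiceType) (G : complex2 V) (W : substitution_word) (o : V) :
  triangulated_surface G -> simply_connected G -> regular_graph G 7 ->
  exists (m : V -> int * int) (F : V -> 'Z_7 -> V),
  [/\ forall v, frame G v (F v),
      forall v j, m (F v j) = level_nbr W (m v) j &
      forall v j, [/\ F (F v j) (level_back W (m v) j) = v,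
                    F (F v j) (level_back W (m v) j + 1) = F v (j - 1) &
                    F (F v j) (level_back W (m v) j - 1) = F v (j + 1)]].
Proof.
move=> tG sG dG.
have fr v : exists f, frame G v f.
  have [s ls] := tG v; apply: (frame_exists ls).
  have [fin] := dG v; rewrite /degree => <-; case: ls => us _ sadj _.
  apply/perm_size/uniq_perm => //.
  by move=> w; rewrite in_fset_set// -sadj; apply/idP/idP; rewrite inE.
have [m [F H]] := development (@level_nbr_inj W) (@level_nbr_back W) fr sG o (0, 0).
exists m, F; split=> [v|v j|v j]; have [f1 f2] := H v => //; by have [] := f2 j.
Qed.

(** By Bernoulli the ratio 513/512 gains a factor 3 over 1024 steps. Of each such factor, 3/2
    absorbs the power of 3/2 and the remaining 2 absorbs the constant, as 2 to the 14 is 16384. *)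
Lemma geometric_gap (R : realFieldType) (n k : nat) : (1024 * k <= n)%N -> (14 <= k)%N ->
  15540 * (3 / 2) ^+ k * (512 / 100) ^+ n <= (513 / 100) ^+ n :> R.
Proof.
move=> kn k14.
pose r : R := 513 / 512.
have r1 : 1 <= r by rewrite /r; lra.
have -> : 513 / 100 = r * (512 / 100) :> R by rewrite /r; lra.
rewrite [(r * _) ^+ n]exprMn ler_pM2r ?exprn_gt0//; last by lra.
have r3 : 3 <= r ^+ 1024.
  have bern i : 1 + i%:R / 512 <= r ^+ i.
    elim: i => [|i IH]; first by rewrite mul0r addr0.
    rewrite exprSr -natr1; have i0 : 0 <= i%:R :> R by [].
    apply: le_trans (ler_wpM2r _ IH); rewrite /r; [nra|lra].
  by have := bern 1024%N; lra.
apply: (@le_trans _ _ (r ^+ (1024 * k))); last by rewrite ler_weXn2l.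
rewrite exprM; apply: (@le_trans _ _ (3 ^+ k)); last first.
  by apply: lerXn2r => //; rewrite ?nnegrE; lra.
have -> : 3 ^+ k = (2 * (3 / 2)) ^+ k :> R by congr (_ ^+ _); lra.
rewrite [(2 * _) ^+ k]exprMn ler_pM2r ?exprn_gt0//; last by lra.
rewrite -natrX ler_nat; apply: leq_trans (leq_pexp2l (isT : (0 < 2)%N) k14).
by vm_compute.
Qed.

(** A Markov-type argument: the pointwise minorant [pt] of [x] is at most [k] when [x >= k] and
    nonpositive when [x < k]; it is then summed. *)
Lemma mean_ge_of_exp_moment (R : realFieldType) (k : nat) (d : seq nat) (S : R) :
  \sum_(x <- d) (2 / 3) ^+ x <= S -> 2 * (3 / 2) ^+ k * S <= (size d)%:R ->
  k%:R * (size d)%:R <= 2 * \sum_(x <- d) x%:R :> R.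
Proof.
move=> dS SN.
have pt (x : nat) : k%:R * (1 - (3 / 2) ^+ k * (2 / 3) ^+ x) <= x%:R :> R.
  have th0 : 0 < 2 / 3 :> R by lra.
  have [kx|xk] := leqP k x.
    apply: (@le_trans _ _ k%:R); last by rewrite ler_nat.
    by rewrite ler_piMr// gerBl mulr_ge0// exprn_ge0//; lra.
  apply: (@le_trans _ _ 0) => //; apply: mulr_ge0_le0 => //.
  rewrite subr_le0 -(subnK (ltnW xk)) exprD -mulrA -exprMn.
  have -> : 3 / 2 * (2 / 3) = 1 :> R by lra.
  by rewrite expr1n mulr1; apply: exprn_ege1; lra.
have : \sum_(x <- d) (k%:R * (1 - (3 / 2) ^+ k * (2 / 3) ^+ x)) <= \sum_(x <- d) x%:R :> R.
  by apply: ler_sum => x _.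
rewrite -mulr_sumr sumrB -mulr_sumr big_const_seq count_predT iter_addr_0.
have := @ler_wpM2l R k%:R.
set A := \sum_(x <- d) _ ^+ x; set X := \sum_(x <- d) _.
have E0 : 0 <= (3 / 2 : R) ^+ k by apply: exprn_ge0; lra.
move=> mono h; have k0 : 0 <= k%:R :> R by [].
have ES := mono k0 _ _ (ler_wpM2l E0 (dS : A <= S)).
have := mono k0 _ _ SN.
by move: ES h; set E := _ ^+ k; lra.
Qed.

(** * Exponential moment and linear displacement *)

Section Main.
Variables (R : realType) (V : choiceType) (G : complex2 V).
Hypothesis hG : infinite_planar_triangulation G.
Hypothesis hdeg : regular_graph G 7.
Variables (o : V) (n : nat).

Lemma displacement_moment : exists2 s : seq (seq V),
  [/\ finite_set (self_avoiding_paths G o n.+1), uniq s,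
      s =i self_avoiding_paths G o n.+1 & (513 / 100) ^+ n.+1 <= 2 * (size s)%:R :> R] &
  \sum_(p <- s) (2 / 3) ^+ graph_dist G o (last o p) <= 3885 * (512 / 100) ^+ n :> R.
Proof.
have [tG sG _] := hG; have [W] := substitution_word_exists.
have [m [F [F_frame m_F F_back]]] := level_development W o tG sG hdeg.
(* The first step has no predecessor, so it is chosen among all seven neighbours; the other [n]
   steps start with empty memory. *)
pose l := [seq F o j :: q | j <- enum 'Z_7,
  q <- state_walks (turn_step W m F) n (turn_state W m F o j 0)].
have Al : self_avoiding_paths G o n.+1 `<=` [set` l].
  move=> [|w q] [] //= /andP[ow pq] uq [sq].
  have [j wj] := (adj_F F_frame o w).1 ow.
  apply/allpairsPdep; exists j, q; rewrite mem_enum wj; split=> //.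
  have := @mem_turn_walks V G W m F F_frame F_back n (turn_state W m F o j 0) q.
  move: uq; rewrite wj /= !inE negb_or => /andP[/andP[_ oq] uq].
  have [-> _ _] := F_back o j.
  by apply=> //; split=> //; rewrite -wj //= -wj.
have fA : finite_set (self_avoiding_paths G o n.+1).
  by apply: sub_finite_set Al _; exact: finite_seq.
exists (enum_fset (fset_set (self_avoiding_paths G o n.+1))).
  split; [by []|exact: fset_uniq|by move=> p; rewrite in_fset_set|].
  apply: le_trans (forward_walks_many m_F _ n.+1 o) _.
  rewrite ler_pM2l// ler_nat; apply: uniq_leq_size.
    by apply: state_walks_uniq => s; exact: forward_step_uniq.
  move=> p /(forward_walksP F_frame m_F)[/= p1 p2 p3 _].
  by rewrite in_fset_set// inE.
have H0 := height_weight_gt0 m R o.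
rewrite -(ler_pM2l H0) mulr_sumr.
apply: (@le_trans _ _ (\sum_(p <- l) height_weight m R (last o p))).
  apply: (@le_trans _ _ (\sum_(p <- enum_fset (fset_set (self_avoiding_paths G o n.+1)))
      height_weight m R (last o p))).
    apply: ler_sum => p _.
    have [[q [pq lq] sq] _] := graph_distP sG.1 o (last o p).
    by rewrite -sq -lq; exact: height_weight_path.
  apply: ler_sum_uniq => [|p|p]; [exact: fset_uniq| |by apply/ltW/height_weight_gt0].
  by rewrite in_fset_set// inE => /Al.
rewrite /l big_allpairs_dep.
(* The first step multiplies the height weight by at most 3/2; with seven choices and the bound 370
   this gives 3885. *)
apply: (@le_trans _ _ (\sum_(j <- enum 'Z_7)
    (512 / 100) ^+ n * (370 * (3 / 2 * height_weight m R o)))).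
  apply: ler_sum => j _; apply: le_trans (turn_walks_few m_F R n (turn_state W m F o j 0)) _.
  rewrite ler_pM2l ?exprn_gt0//; last by lra.
  rewrite ler_pM2l//= (height_weight_F m_F) mulrC ler_pM2r// /level_weight.
  by case: j => -[|[|[|[|[|[|[|//]]]]]]] lt; case: nb_letter => /=; lra.
rewrite big_const_seq count_predT size_enum_ord iter_addr_0.
rewrite -[leLHS]mulr_natl (_ : (Zp_trunc 7).+2%:R = 7)//.
by rewrite le_eqVlt; apply/orP; left; apply/eqP; set L := _ ^+ n; lra.
Qed.
End Main.

Theorem theorem1p1 (R : realType) (V : choiceType) (G : complex2 V)
    (hG : infinite_planar_triangulation G) (hdeg : regular_graph G 7) :
  exists c : R, 0 < c /\
    forall (o : V) (n : nat), (1 <= n)%N ->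
      c * n%:R < expected_displacement R G o n.
Proof.
(* The constant must cover all lengths up to 1024 * 14 = 14336, where only displacement at least 1
   is used. *)
exists (1 / 20000); split; first by lra.
move=> o [//|n] _.
have [s [fA us sA Ns] ms] := displacement_moment R hG hdeg o n.
have [_ [conn _] _] := hG.
have eqs : perm_eq (enum_fset (fset_set (self_avoiding_paths G o n.+1))) s.
  apply: uniq_perm; [exact: fset_uniq|exact: us|].
  by move=> p; rewrite in_fset_set// sA.
rewrite /expected_displacement /uniform_expectation fsbig_finite//.
rewrite (perm_big _ eqs) (perm_size eqs).
pose d := [seq graph_dist G o (last o p) | p <- s].
have -> : \sum_(p <- s) (graph_dist G o (last o p))%:R = \sum_(x <- d) x%:R :> R.
  by rewrite big_map.
have -> : size s = size d by rewrite size_map.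
have N0 : 0 < (size d)%:R :> R.
  by have := exprn_gt0 n.+1 (_ : 0 < 513 / 100 :> R); rewrite size_map; lra.
rewrite ltr_pdivlMr//.
have d1 : (size d)%:R <= \sum_(x <- d) x%:R :> R.
  rewrite -sum1_size natr_sum /d !big_map big_seq [leRHS]big_seq.
  apply: ler_sum => p; rewrite sA inE => -[pp up sp].
  rewrite ler_nat graph_dist_gt0//.
  case: p up sp {pp} => //= w q /andP[oq _] _.
  by apply: contraNneq oq => ->; exact: mem_last.
have [k kn nkR] : exists2 k, (1024 * k <= n.+1)%N &
    n.+1%:R <= 1024 * (k%:R + 1) :> R.
  exists (n.+1 %/ 1024)%N; first by rewrite mulnC leq_trunc_div.
  by rewrite natr1 -natrM ler_nat ltnW// mulnC ltn_ceil.
have [k14|k14] := leqP 14 k; last first.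
  have k14R : k%:R <= 13 :> R by rewrite ler_nat.
  apply: lt_le_trans d1; rewrite gtr_pMl//.
  by clear kn k14; lra.
have k14R : 14 <= k%:R :> R by rewrite ler_nat.
have L0 : 0 <= (512 / 100) ^+ n :> R by apply: exprn_ge0; clear; lra.
have E0 : 0 <= (3 / 2) ^+ k :> R by apply: exprn_ge0; clear; lra.
have gap := geometric_gap R kn k14; clear kn k14.
(* Here 15540 is 4 * 3885: one factor 2 is in this inequality, the other in the lower bound for the
   number of paths. *)
have Ek : 2 * (3 / 2) ^+ k * (3885 * (512 / 100) ^+ n) <= (size d)%:R :> R.
  have EL := mulr_ge0 E0 L0.
  have NR : 15540 * (3 / 2) ^+ k * (512 / 100) ^+ n.+1 <= 2 * (size d)%:R :> R.
    by apply: le_trans gap _; rewrite size_map.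
  by move: NR EL; rewrite exprS; set E := _ ^+ k; set L := _ ^+ n; lra.
clear gap Ns; have := @mean_ge_of_exp_moment R k d _ _ Ek; rewrite {1}big_map => /(_ ms).
set N := _%:R in N0 *; set X := \sum_(x <- d) _ => kX.
have : 0 < (k%:R / 2 - 1 / 20000 * n.+1%:R) * N by apply: mulr_gt0 => //; lra.
by lra.
Qed.
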